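(* Let $X_0, X_1$ be finite subsets of $\mathbb{Z}^n$, let $\kappa$ be an adjacency on $\mathbb{Z}^n$, and suppose $(X,\kappa) = (X_0,\kappa) \vee (X_1,\kappa)$ is the wedge of $(X_0,\kappa)$ and $(X_1,\kappa)$ with wedge point $x_0$, i.e., $\{x_0\} = X_0 \cap X_1$. Suppose $\#X_0 > 1$ and $\#X_1 > 1$. If $(X_0,\kappa)$ and $(X_1,\kappa)$ are both irreducible, then $(X,\kappa)$ is irreducible.
   Context: A digital image is a pair $(X,\kappa)$ where $X \subset \mathbb{Z}^n$ for some $n \in \mathbb{N}$ and $\kappa$ is an adjacency relation (a symmetric, irreflexive binary relation) on $X$; thus it is a simple graph. Write $x \leftrightarrow_\kappa y$ if $x,y$ are $\kappa$-adjacent. $\#X$ denotes the number of points of $X$. No connectedness is assumed. A function $f:(X,\kappa)\to(Y,\lambda)$ is $(\kappa,\lambda)$-continuous if $x \leftrightarrow_\kappa x'$ implies $f(x)=f(x')$ or $f(x)\leftrightarrow_\lambda f(x')$. Homotopy: For integers $a\le b$, $[a,b]_{\mathbb{Z}}=\{z\in\mathbb{Z} : a\le z\le b\}$, where $z,z'$ are adjacent iff $|z-z'|=1$. Continuous functions $f,g:(X,\kappa)\to(Y,\lambda)$ are homotopic if there are a positive integer $m$ and $F:X\times[0,m]_{\mathbb{Z}}\to Y$ such that $F(x,0)=f(x)$ and $F(x,m)=g(x)$ for all $x\in X$; for each $x\in X$ the map $t\mapsto F(x,t)$ is continuous (i.e., $F(x,t)$ and $F(x,t+1)$ are equal or adjacent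 for $0\le t<m$); and for each $t$ the map $x\mapsto F(x,t)$ is $(\kappa,\lambda)$-continuous. Digital images $(X,\kappa)$ and $(Y,\lambda)$ are homotopy equivalent if there are continuous maps $f:X\to Y$, $g:Y\to X$ with $g\circ f$ homotopic to $\mathrm{id}_X$ and $f\circ g$ homotopic to $\mathrm{id}_Y$. A finite digital image is reducible if it is homotopy equivalent to a digital image with fewer points; otherwise it is irreducible. Wedge: let $X_0\cup X_1\subset \mathbb{Z}^n$ with adjacency $\kappa$ be such that $X_0\cap X_1=\{x_0\}$ for some point $x_0$, and suppose that whenever $x\in X_0$, $y\in X_1$ and ($x=y$ or $x\leftrightarrow_\kappa y$), we have $x_0\in\{x,y\}$. Then $X=X_0\cup X_1$ (with adjacency $\kappa$) is called the wedge of $X_0$ and $X_1$, denoted $X_0\vee X_1$, and $x_0$ is the wedge point. *)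

(* Defs.v *)
From HB Require Import structures.
From mathcomp Require Import all_boot all_order all_algebra.
From mathcomp Require Import finmap.

Set Implicit Arguments.
Unset Strict Implicit.
Unset Printing Implicit Defensive.

Local Open Scope fset_scope.

Definition adjacency (T : Type) (k : rel T) : Prop :=
  symmetric k /\ irreflexive k.

(* Only finite digital images are packaged: every image occurring in the
   notion of reducibility of a finite image is finite, since an image with
   fewer points than a finite one is itself finite. *)
Record digital_image := DigitalImage {
  dim : nat;
  points : {fset 'rV[int]_dim};
  adj : rel points;
  adjP : adjacency adj
}.

Section Continuity.
Variables (A B : Type) (k : rel A) (l : rel B).

Definition dcontinuous (f : A -> B) : Prop :=
  forall x x' : A, k x x' -> f x = f x' \/ l (f x) (f x').

End Continuity.

(* The digital interval [0, m]_Z is the type 'I_m.+1 with this adjacency. *)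
Definition interval_adj (m : nat) : rel 'I_m.+1 :=
  fun s t => `|s - t|%N == 1%N.

Definition homotopic (X Y : digital_image) (f g : points X -> points Y) : Prop :=
  exists (m : nat) (F : points X -> 'I_m.+1 -> points Y),
    [/\ (0 < m)%N,
        forall x, F x ord0 = f x,
        forall x, F x ord_max = g x,
        forall x, dcontinuous (@interval_adj m) (@adj Y) (F x)
      & forall t, dcontinuous (@adj X) (@adj Y) (fun x => F x t)].

Definition homotopy_equivalent (X Y : digital_image) : Prop :=
  exists (f : points X -> points Y) (g : points Y -> points X),
    [/\ dcontinuous (@adj X) (@adj Y) f,
        dcontinuous (@adj Y) (@adj X) g,
        homotopic (g \o f) id
      & homotopic (f \o g) id].

(* The dimension and the adjacency of Y are unrelated to those of X. *)
Definition reducible (X : digital_image) : Prop :=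
  exists Y : digital_image,
    homotopy_equivalent X Y /\ (#|` points Y| < #|` points X|)%N.

Definition irreducible (X : digital_image) : Prop := ~ reducible X.

Section Restriction.
Variables (n : nat) (k : rel 'rV[int]_n) (hk : adjacency k).
Variable X : {fset 'rV[int]_n}.

Definition restrict_adj : rel X := fun x y => k (val x) (val y).

Lemma restrict_adjP : adjacency restrict_adj.
Proof.
case: hk => sk ik.
by split=> [x y|x]; rewrite /restrict_adj; [apply: sk | apply: ik].
Qed.

Definition subimage : digital_image := DigitalImage restrict_adjP.

End Restriction.

Definition is_wedge (n : nat) (k : rel 'rV[int]_n)
    (X X0 X1 : {fset 'rV[int]_n}) (x0 : 'rV[int]_n) : Prop :=
  [/\ X = X0 `|` X1,
      X0 `&` X1 = [fset x0]
    & forall x y, x \in X0 -> y \in X1 -> x = y \/ k x y ->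
        x0 = x \/ x0 = y].

(* Main.v *)
(** Call a self-map a perturbation of the identity if it is continuous and
    moves every point to itself or to a neighbour.  A finite image is
    irreducible iff all such maps are surjective.  Given a perturbation [f] of
    the identity on the wedge, following its restriction to [X_i] by the
    retraction collapsing the other summand to [x0] gives a perturbation of the
    identity on [X_i], which is surjective by irreducibility; hence [f] hits
    every point other than [x0].  If moreover [f x0] lies in [X_i], then [f]
    maps [X_i] into itself, as only [x0] has neighbours outside [X_i], so no
    collapsing takes place and [f] hits [x0] as well. *)
Require Import Defs.
From HB Require Import structures.
From mathcomp Require Import all_boot all_order all_algebra.
From mathcomp Require Import all_fingroup finmap.

Local Open Scope fset_scope.

Definition perturbation (X : digital_image) (f : points X -> points X) : Prop :=
  dcontinuous (@adj X) (@adj X) f /\ forall x, f x = x \/ adj (f x) x.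

Lemma dcontinuous_comp (A B C : Type) (k : rel A) (l : rel B) (m : rel C)
    (g : B -> C) (f : A -> B) :
  dcontinuous l m g -> dcontinuous k l f -> dcontinuous k m (g \o f).
Proof.
move=> cg cf x x' /cf [/= ->|/cg //]; by left.
Qed.

Lemma dcontinuous_iter (A : Type) (k : rel A) (f : A -> A) (n : nat) :
  dcontinuous k k f -> dcontinuous k k (iter n f).
Proof.
move=> cf; elim: n => [|n IHn]; first by move=> x x'; right.
exact: dcontinuous_comp cf IHn.
Qed.

Lemma homotopic_adjacent (X Y : digital_image) (f g : points X -> points Y) :
  dcontinuous (@adj X) (@adj Y) f -> dcontinuous (@adj X) (@adj Y) g ->
  (forall x, f x = g x \/ adj (f x) (g x)) -> homotopic f g.
Proof.
move=> cf cg fg.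
have [symY _] := adjP Y.
exists 1%N, (fun x (t : 'I_2) => if t == ord0 then f x else g x); split=> //.
- move=> x s t _; case: (s == _); case: (t == _); [by left | exact: fg | | by left].
  by case: (fg x) => [->|]; [left | right; rewrite symY].
- by move=> t; case: (t == _).
Qed.

(* By finiteness, the inverse of a bijection is one of its iterates. *)
Lemma continuous_bijection_inverse (X : digital_image)
    (g : points X -> points X) :
  dcontinuous (@adj X) (@adj X) g -> injective g ->
  exists2 h, dcontinuous (@adj X) (@adj X) h & cancel h g.
Proof.
move=> cg ig; pose s := perm ig.
exists (iter #[s]%g.-1 g) => [|x]; first exact: dcontinuous_iter.
rewrite -iterS prednK ?order_gt0 //.
rewrite -[RHS](perm1 x) -(expg_order s) permX.
by apply: eq_iter => y; rewrite permE.
Qed.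

(** If [f] misses a point, then [f] onto its image and the inclusion of that image are inverse up to
    homotopy: both composites act as [f], one step away from the identity. *)
Lemma irreducible_perturbation_surj (X : digital_image)
    (f : points X -> points X) :
  irreducible X -> perturbation X f -> forall y, exists x, f x = y.
Proof.
move=> irrX [cf nf] y.
have [/existsP[x /eqP <-]|/existsPn nfy] := boolP [exists x, f x == y].
  by exists x.
case: irrX.
pose Z := [fset val (f x) | x in [set: points X]].
have ZX : Z `<=` points X by apply/fsubsetP => _ /imfsetP[x _ ->]; apply: valP.
have fZ x : val (f x) \in Z by apply: in_imfset; rewrite inE.
(* Pulling [adj] back along the inclusion makes the inclusion continuous by construction. *)
have adjZ : adjacency (fun u v : Z => adj (fincl ZX u) (fincl ZX v)).
  have [sX iX] := adjP X; by split=> [u v|u]; [apply: sX | apply: iX].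
pose Y := DigitalImage adjZ.
pose p (x : points X) : points Y := [` fZ x].
have pK x : fincl ZX (p x) = f x by apply: val_inj.
have pI (u : points Y) : p (fincl ZX u) = u \/ adj (p (fincl ZX u)) u.
  have [e|] := nf (fincl ZX u); last by right; rewrite /= pK.
  by left; apply: val_inj; rewrite /= e.
have cp : dcontinuous (@adj X) (@adj Y) p.
  move=> x x' /cf [e|]; last by right; rewrite /= !pK.
  by left; apply: val_inj; rewrite /= e.
have ci : dcontinuous (@adj Y) (@adj X) (fincl ZX) by move=> u v; right.
exists Y; split; last first.
  apply: fproper_ltn_card; rewrite fproperEneq ZX andbT.
  apply/eqP => /= ZE; have : val y \in Z by rewrite ZE; apply: valP.
  by case/imfsetP => x _ /val_inj e; have := nfy x; rewrite e eqxx.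
exists p, (fincl ZX); split=> //.
- apply: homotopic_adjacent => [|x x'|x]; [exact: dcontinuous_comp ci cp| by right|].
  by rewrite /= pK.
- by apply: homotopic_adjacent => [|x x'|x]; [exact: dcontinuous_comp cp ci| by right| exact: pI].
Qed.

(* In a homotopy from a non-surjective map to the identity, take a
   non-surjective stage followed by a surjective one, and precompose the former
   with the inverse of the latter. *)
Lemma reducible_perturbation (X : digital_image) :
  reducible X ->
  exists f : points X -> points X,
    perturbation X f /\ ~ (forall y, exists x, f x = y).
Proof.
case=> Y [[p [q [cp cq [m [F [_ F0 Fm Ft cF]]] _]]] ltYX].
pose P t := [forall y, exists x, F x (inord t) == y].
(* Stage 0 is [q \o p], which factors through the smaller image [Y]. *)
have nP0 : ~~ P 0%N.
  apply/negP => /forallP surj; move: ltYX; rewrite ltnNge !cardfE => /negP; apply.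
  have sub : {subset predT <= codom q}.
    move=> y _; have /existsP[x /eqP <-] := surj y.
    have -> : inord 0 = ord0 :> 'I_m.+1 by apply: val_inj; rewrite /= inordK.
    by rewrite F0; apply: codom_f.
  have /subset_leq_card := introT subsetP sub.
  by move=> /leq_trans; apply; rewrite leq_image_card.
have Pm : P m.
  apply/forallP => y; apply/existsP; exists y.
  have -> : inord m = ord_max :> 'I_m.+1 by apply: val_inj; rewrite /= inordK.
  by rewrite Fm.
have [t [ltm nPt Pt]] : exists t, [/\ (t < m)%N, ~~ P t & P t.+1].
  case: (ex_minnP (ex_intro _ m Pm)) => -[|t] Pt tmin; first by rewrite Pt in nP0.
  exists t; split=> //; first exact: tmin.
  by apply/negP => /tmin; rewrite ltnn.
pose g x := F x (inord t.+1); pose f x := F x (inord t).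
have ig : injective g.
  apply/injectiveP; rewrite /dinjectiveb; apply/card_uniqP.
  rewrite size_map -cardE; apply: eq_card => y; rewrite [RHS]inE.
  by have /existsP[x /eqP <-] := forallP Pt y; apply: codom_f.
have [h ch hK] := continuous_bijection_inverse _ _ (cF _) ig.
exists (f \o h); split; first split.
- exact: dcontinuous_comp (cF _) ch.
(* As [x = g (h x)], the points [f (h x)] and [x] are consecutive on the path [F (h x)]. *)
- move=> x; rewrite -[x in _ = x]hK -[x in adj _ x]hK; apply: Ft.
  by rewrite /interval_adj (inordK (leqW ltm)) inordK ?IntDist.distnS.
- move=> surj; move/negP: nPt; apply; apply/forallP => y; apply/existsP.
  by have [x <-] := surj y; exists (h x).
Qed.

Section WedgeSummand.
Variables (n : nat) (k : rel 'rV[int]_n) (hk : adjacency k).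
Variables (X Z : {fset 'rV[int]_n}) (x0 : 'rV[int]_n).
Hypotheses (ZX : Z `<=` X) (x0Z : x0 \in Z).
Hypothesis attached :
  forall x y, x \in Z -> y \in X -> y \notin Z -> k x y -> x = x0.

Definition collapse (x : X) : Z := insubd [` x0Z] (val x).

Lemma val_collapse x : val (collapse x) = if val x \in Z then val x else x0.
Proof. exact: val_insubd. Qed.

(** An edge with an end outside [Z] can meet [Z] only at [x0], so both its ends collapse to [x0]. *)
Lemma collapse_continuous :
  dcontinuous (@adj (subimage hk X)) (@adj (subimage hk Z)) collapse.
Proof.
have [sk _] := hk.
move=> x x' /= kxx'; rewrite /restrict_adj !val_collapse.
case: ifPn => xZ; case: ifPn => x'Z; [by right | left | left | left];
  apply: val_inj; rewrite !val_collapse ?(negPf xZ) ?(negPf x'Z) ?xZ ?x'Z //.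
- exact: attached xZ (valP x') x'Z kxx'.
- by apply/esym/(attached _ _ x'Z (valP x) xZ); rewrite sk.
Qed.

(** A preimage of [z] under the collapsed map is one under [f] unless [f] sends it out of [Z]. That
    would force both it and [z] to be [x0], which each alternative of the last hypothesis
    excludes. *)
Lemma perturbation_image_summand
    (f : points (subimage hk X) -> points (subimage hk X)) (z : Z) :
  irreducible (subimage hk Z) -> perturbation (subimage hk X) f ->
  val z != x0 \/ val (f (fincl ZX [` x0Z])) \in Z -> exists x, f x = fincl ZX z.
Proof.
have [sk _] := hk.
move=> irrZ [cf nf] zP.
have ci : dcontinuous (@adj (subimage hk Z)) (@adj (subimage hk X)) (fincl ZX).
  by move=> u v; right.
have collapseK u : collapse (fincl ZX u) = u.
  by apply: val_inj; rewrite val_collapse /= fsvalP.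
pose g := collapse \o (f \o fincl ZX).
have pg : perturbation (subimage hk Z) g.
  split.
    by apply: dcontinuous_comp collapse_continuous _; apply: dcontinuous_comp cf ci.
  (* Since [collapse] fixes [u], its continuity applies to the edge between [f u] and [u]. *)
  move=> u; rewrite -[u in _ = u]collapseK -[u in adj _ u]collapseK.
  have [e|a] := nf (fincl ZX u); first by left; rewrite /g /= e.
  exact: collapse_continuous a.
have [u gu] := irreducible_perturbation_surj _ _ irrZ pg z.
exists (fincl ZX u); apply: val_inj; rewrite /= -gu val_collapse /=.
case: ifPn => // fuZ.
have z_x0 : val z = x0 by rewrite -gu val_collapse /= (negPf fuZ).
have u_x0 : val u = x0.
  have [e|a] := nf (fincl ZX u); first by rewrite e /= fsvalP in fuZ.
  by apply: attached (valP u) (valP _) fuZ _; rewrite sk.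
case: zP => [|fx0Z]; first by rewrite z_x0 eqxx.
have e : u = [` x0Z] by apply: val_inj.
by rewrite e fx0Z in fuZ.
Qed.

End WedgeSummand.

Theorem theorem4p3 (n : nat) (k : rel 'rV[int]_n) (hk : adjacency k)
    (X X0 X1 : {fset 'rV[int]_n}) (x0 : 'rV[int]_n)
    (hwedge : is_wedge k X X0 X1 x0)
    (card_X0 : (1 < #|` X0|)%N) (card_X1 : (1 < #|` X1|)%N)
    (irr_X0 : irreducible (subimage hk X0))
    (irr_X1 : irreducible (subimage hk X1)) :
  irreducible (subimage hk X).
Proof.
have [sk _] := hk; have [XE XI sep] := hwedge.
have /andP[x0X0 x0X1] : (x0 \in X0) && (x0 \in X1) by rewrite -in_fsetI XI inE.
have X0X : X0 `<=` X by rewrite XE fsubsetUl.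
have X1X : X1 `<=` X by rewrite XE fsubsetUr.
(* A neighbour outside one summand lies in the other, so [sep] makes one end [x0]; it is not the
   outer end, as [x0] is in both summands. *)
have att0 x y : x \in X0 -> y \in X -> y \notin X0 -> k x y -> x = x0.
  move=> xX0; rewrite XE inE => /orP[->//|yX1] yX0 kxy.
  have [->//|e] := sep x y xX0 yX1 (or_intror kxy).
  by rewrite -e x0X0 in yX0.
have att1 x y : x \in X1 -> y \in X -> y \notin X1 -> k x y -> x = x0.
  move=> xX1; rewrite XE inE => /orP[yX0|->//] yX1 kxy.
  rewrite sk in kxy; have [e|->//] := sep y x yX0 xX1 (or_intror kxy).
  by rewrite -e x0X1 in yX1.
move=> /reducible_perturbation[f [pf]]; apply=> y.
have cover0 := perturbation_image_summand _ _ hk _ _ _ X0X x0X0 att0 f _ irr_X0 pf.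
have cover1 := perturbation_image_summand _ _ hk _ _ _ X1X x0X1 att1 f _ irr_X1 pf.
have same : fincl X0X [` x0X0] = fincl X1X [` x0X1] by apply: val_inj.
have hit0 (yX0 : val y \in X0) :
    val y != x0 \/ val (f (fincl X0X [` x0X0])) \in X0 -> exists x, f x = y.
  move=> /(cover0 [` yX0])[x fx]; exists x; rewrite fx; exact: val_inj.
have hit1 (yX1 : val y \in X1) :
    val y != x0 \/ val (f (fincl X1X [` x0X1])) \in X1 -> exists x, f x = y.
  move=> /(cover1 [` yX1])[x fx]; exists x; rewrite fx; exact: val_inj.
(* Away from [x0], a summand containing [y] provides the preimage; for [x0] itself, the summand
   containing the image of [x0] does. *)
have [y_x0|y_x0] := eqVneq (val y) x0; last first.
  have : val y \in X0 `|` X1 by rewrite -XE; apply: valP.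
  by rewrite inE => /orP[yX0|yX1]; [apply: hit0 | apply: hit1]; rewrite ?y_x0 //; left.
have : val (f (fincl X0X [` x0X0])) \in X0 `|` X1 by rewrite -XE; apply: valP.
rewrite inE => /orP[fX0|fX1]; [apply: hit0|apply: hit1]; rewrite ?y_x0 //; right=> //.
by rewrite -same.
Qed.
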